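(* Let $k>2$ and let a rigid hypersurface in $\mathbb C^2$ be given by $$v=x^k+F(x,y),\qquad F(x,y)=\sum_{j+l\ge k+1}A_{j,l}\,x^jy^l .$$ There exists a unique (formal) transformation of the form $$z^*=z+\sum_{i=2}^\infty f_iz^i,\qquad w^*=w+\sum_{i=k+1}^\infty g_iz^i$$ which takes $F$ into rigid t-normal form.
   Context: Coordinates in $\mathbb C^2$ are $(z,w)$ with $z=x+iy$, $w=u+iv$ (and similarly with stars). $F$ is a real-valued (real analytic or formal) power series; $f_i,g_i\in\mathbb C$. The transformed hypersurface is written $v^*=(x^* )^k+F^*(x^*,y^* )$ with $F^*(x^*,y^* )=\sum_{j+l\ge k+1}A^*_{j,l}(x^* )^j(y^* )^l$. The function $F=\sum_{j+l\ge k+1}A_{j,l}x^jy^l$ is in rigid t-normal form if $$A_{0,j}=A_{1,j}=A_{k-1,j}=A_{k,j}=0\quad\text{for all } j=0,1,2,\dots$$ (the leading term $x^k$ is not part of $F$). Taking $F$ into rigid t-normal form means that $F^*$ satisfies these conditions. *)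

(* Defs.v *)
From mathcomp Require Import all_boot all_order all_algebra.
From mathcomp Require Import reals complex.
Set Implicit Arguments.
Unset Strict Implicit.
Unset Printing Implicit Defensive.
Import Order.TTheory GRing.Theory Num.Theory.
Local Open Scope ring_scope.

(* [F a b] is the coefficient of x^a y^b in a formal power series F in the
   commuting variables x, y.  The arrow type is used only as a carrier: the
   product is [psmul] (Cauchy), never a pointwise product of functions. *)
Definition ps2 (K : Type) := nat -> nat -> K.

Section PowerSeries.
Variable K : comNzRingType.
Implicit Types F G X Y : ps2 K.

Definition psconst (c : K) : ps2 K :=
  fun a b => if (a == 0%N) && (b == 0%N) then c else 0.
Definition psX : ps2 K := fun a b => ((a == 1%N) && (b == 0%N))%:R.
Definition psY : ps2 K := fun a b => ((a == 0%N) && (b == 1%N))%:R.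

Definition psadd F G : ps2 K := fun a b => F a b + G a b.
Definition psmul F G : ps2 K := fun a b =>
  \sum_(i < a.+1) \sum_(j < b.+1) F i j * G (a - i)%N (b - j)%N.
Definition psexp F (n : nat) : ps2 K := iter n (psmul F) (psconst 1).

(* The two substitutions below are meaningful for series without constant
   term (the only case in which they are used): then X^i, respectively
   X^j Y^l, has no monomial of degree less than i, respectively j + l, so the
   finite sums contain every nonzero contribution to the coefficient of
   x^a y^b. *)
Definition pssubst1 (f : nat -> K) X : ps2 K := fun a b =>
  \sum_(i < (a + b).+1) f i * psexp X i a b.
Definition pssubst2 F X Y : ps2 K := fun a b =>
  \sum_(j < (a + b).+1) \sum_(l < (a + b).+1)
    F j l * psmul (psexp X j) (psexp Y l) a b.

Definition order_ge (n : nat) F : Prop :=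
  forall j l : nat, (j + l < n)%N -> F j l = 0.

Definition rigid_t_normal (k : nat) F : Prop :=
  forall j : nat,
    [/\ F 0%N j = 0, F 1%N j = 0, F k.-1 j = 0 & F k j = 0].

End PowerSeries.

Arguments psX {K}.
Arguments psY {K}.

Section Transformation.
Variable R : realType.

(* Since x and y are real, real and imaginary parts of a series in x, y with
   complex coefficients are taken coefficientwise. *)
Definition psRe (S : ps2 R[i]) : ps2 R := fun a b => complex.Re (S a b).
Definition psIm (S : ps2 R[i]) : ps2 R := fun a b => complex.Im (S a b).
Definition pscomplex (P Q : ps2 R) : ps2 R[i] := fun a b => (P a b +i* Q a b)%C.

(* T = (f, g) encodes z* = z + \sum_i f_i z^i, w* = w + \sum_i g_i z^i; the
   vanishing conditions make the sums start at i = 2 and i = k + 1. *)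
Definition transformation (k : nat) (T : (nat -> R[i]) * (nat -> R[i])) : Prop :=
  (forall i : nat, (i < 2)%N -> T.1 i = 0) /\
  (forall i : nat, (i < k.+1)%N -> T.2 i = 0).

Definition zser : ps2 R[i] := pscomplex psX psY.

(* w = u + iv at the point of v = x^k + F(x,y) with parameters x, y and u. *)
Definition wser (k : nat) (F : ps2 R) (u : R) : ps2 R[i] :=
  pscomplex (psconst u) (psadd (psexp psX k) F).

Definition zstar (T : (nat -> R[i]) * (nat -> R[i])) : ps2 R[i] :=
  psadd zser (pssubst1 T.1 zser).
Definition wstar (k : nat) (F : ps2 R) (T : (nat -> R[i]) * (nat -> R[i]))
    (u : R) : ps2 R[i] :=
  psadd (wser k F u) (pssubst1 T.2 zser).

(* T sends v = x^k + F(x,y) into v* = (x* )^k + Fs(x*, y* ): the second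
   equation holds identically along the first hypersurface. *)
Definition takes_into (k : nat) (T : (nat -> R[i]) * (nat -> R[i]))
    (F Fs : ps2 R) : Prop :=
  let xs := psRe (zstar T) in
  let ys := psIm (zstar T) in
  forall u : R,
    psIm (wstar k F T u) =2 psadd (psexp xs k) (pssubst2 Fs xs ys).

End Transformation.

(* Main.v *)
Require Import Defs.
From mathcomp Require Import all_boot all_order all_algebra.
From mathcomp Require Import reals complex.
From mathcomp Require Import boolp zify ring.
Set Implicit Arguments.
Unset Strict Implicit.
Unset Printing Implicit Defensive.
Import Order.TTheory GRing.Theory Num.Theory.
Local Open Scope ring_scope.

(** Order the equation [v* = x*^k + Fs] by total degree in [x, y].  For
    [n >= k + 1] the coefficients that occur in degree [n] for the first time are
    [g_n], [f_m] with [m = n - k + 1], and those of the degree [n] part [Fs_n],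
    and they occur linearly: the equation reads
    [Fs_n = Im (g_n z^n) - k x^(k-1) Re (f_m z^m) + known terms].
    Normality asks that the coefficients of [x^0], [x^1], [x^(k-1)], [x^k] in
    [Fs_n] vanish.  Since [k > 2], the term [x^(k-1) Re (f_m z^m)] contributes
    nothing to the first two, which therefore are two real equations for [g_n];
    they are uniquely solvable because the coefficients of [y^n] and
    [x y^(n-1)] in [g z^n] are [g i^n] and [n g i^(n-1)], and their imaginary
    parts are, up to sign and the factor [n], the real and imaginary parts of
    [g i^n].  Once [g_n] is known, the last two conditions determine [f_m] in
    the same way, and induction on [n] concludes.

    The weight of the proof lies in the claim about the first occurrences,
    which is [takes_into_sub].  It compares two transformations that agree up to
    the coefficients in question, and rests on the first-order expansion of
    [x*^k] ([psexp_first_order]) and of the substitution into [Fs]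
    ([pssubst2_sub]).  One degree is solved in [normalizes_at_step], and
    [triangular_exists_unique] assembles the degrees. *)

(** * Truncated products of power series *)

Section Series.
Variable K : comNzRingType.
Implicit Types F G X Y : ps2 K.

Lemma ps2P F G : F =2 G -> F = G.
Proof. by move=> FG; apply/funext => a; apply/funext => b; apply: FG. Qed.

Definition agree_below (n : nat) F G : Prop :=
  forall a b : nat, (a + b < n)%N -> F a b = G a b.

Lemma agree_below_sym n F G : agree_below n F G -> agree_below n G F.
Proof. by move=> FG a b /FG. Qed.

Lemma agree_belowW m n F G : (m <= n)%N -> agree_below n F G -> agree_below m F G.
Proof. by move=> mn FG a b abm; apply: FG; apply: leq_trans mn. Qed.

Lemma agree_below_order n F G : agree_below n F G -> order_ge n F -> order_ge n G.
Proof. by move=> FG oF a b abn; rewrite -FG// oF. Qed.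

Definition psmono (p q : nat) : ps2 K := fun a b => ((a == p) && (b == q))%:R.

Lemma psconst1E : psconst 1 = psmono 0 0.
Proof. by apply: ps2P => a b; rewrite /psconst /psmono; case: andP. Qed.

Lemma psmono_order p q : order_ge (p + q) (psmono p q).
Proof. by move=> a b ab; rewrite /psmono; case: andP => // -[/eqP ? /eqP ?]; lia. Qed.

Lemma psmulC F G : psmul F G = psmul G F.
Proof.
apply: ps2P => a b; rewrite /psmul (reindex_inj rev_ord_inj) /=.
apply: eq_bigr => i _; rewrite (reindex_inj rev_ord_inj) /=.
by apply: eq_bigr => j _; rewrite !subSS !subKn -1?ltnS// mulrC.
Qed.

Lemma psmulBl F F' G a b :
  psmul (fun i j => F i j - F' i j) G a b = psmul F G a b - psmul F' G a b.
Proof.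
rewrite /psmul -sumrB; apply: eq_bigr => i _; rewrite -sumrB.
by apply: eq_bigr => j _; rewrite mulrBl.
Qed.

Lemma psmulBr F G G' a b :
  psmul F (fun i j => G i j - G' i j) a b = psmul F G a b - psmul F G' a b.
Proof. by rewrite -[in LHS]psmulC psmulBl !(psmulC F). Qed.

Lemma sum_pick n p (H : nat -> K) :
  \sum_(i < n.+1) (i == p :> nat)%:R * H i = if (p <= n)%N then H p else 0.
Proof.
case: leqP => pn.
  rewrite (bigD1 (Ordinal (pn : (p < n.+1)%N)))//= eqxx mul1r big1 ?addr0// => i.
  by rewrite -val_eqE/= => /negbTE->; rewrite mul0r.
by rewrite big1// => i _; rewrite ltn_eqF ?mul0r// (leq_ltn_trans _ pn)// -ltnS.
Qed.

Lemma psmul_monol p q G a b :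
  psmul (psmono p q) G a b =
  if (p <= a)%N && (q <= b)%N then G (a - p)%N (b - q)%N else 0.
Proof.
have -> : psmul (psmono p q) G a b = \sum_(i < a.+1) (i == p :> nat)%:R *
    \sum_(j < b.+1) (j == q :> nat)%:R * G (a - i)%N (b - j)%N.
  apply: eq_bigr => i _; rewrite mulr_sumr; apply: eq_bigr => j _.
  by rewrite /psmono -mulnb natrM mulrA.
rewrite (sum_pick _ _ (fun i => \sum_(j < b.+1) (j == q :> nat)%:R * G (a - i)%N (b - j)%N)).
by case: leqP => //= _; rewrite (sum_pick _ _ (fun j => G (a - p)%N (b - j)%N)).
Qed.

Lemma psmul_mono p q r s : psmul (psmono p q) (psmono r s) = psmono (p + r) (q + s).
Proof.
apply: ps2P => a b; rewrite psmul_monol /psmono.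
case: (leqP p a) => pa /=; last by case: eqP => //= ?; lia.
case: (leqP q b) => qb /=; last by rewrite andbC; case: eqP => //= ?; lia.
by congr (_ && _)%:R; apply/eqP/eqP; lia.
Qed.

Lemma psexpX n : psexp psX n = psmono n 0.
Proof.
elim: n => [|n IH]; first exact: psconst1E.
by rewrite /psexp iterS -/(psexp _ n) IH psmul_mono.
Qed.

Lemma psexpY n : psexp psY n = psmono 0 n.
Proof.
elim: n => [|n IH]; first exact: psconst1E.
by rewrite /psexp iterS -/(psexp _ n) IH psmul_mono.
Qed.

Lemma psexpS F n : psexp F n.+1 = psmul F (psexp F n).
Proof. by []. Qed.

(** The gain over plain congruence: a factor of order [q] pushes a disagreement
    of the other factor up by [q] degrees.  This is what makes the unknown
    coefficients enter the equations in a triangular way. *)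
Lemma psmul_agree p q r F F' G G' :
  order_ge p F -> order_ge p F' -> order_ge q G -> order_ge q G' ->
  agree_below (p + r) F F' -> agree_below (q + r) G G' ->
  agree_below (p + q + r) (psmul F G) (psmul F' G').
Proof.
move=> oF oF' oG oG' FF' GG' a b ab; apply: eq_bigr => i _; apply: eq_bigr => j _.
have := ltn_ord i; have := ltn_ord j => jb ia.
have [lt_p|ge_p] := ltnP (i + j) p; first by rewrite oF// oF'// !mul0r.
have [lt_q|ge_q] := ltnP ((a - i) + (b - j)) q; first by rewrite oG// oG'// !mulr0.
by rewrite FF' ?GG'//; lia.
Qed.

Lemma psmul_order p q F G : order_ge p F -> order_ge q G -> order_ge (p + q) (psmul F G).
Proof.
move=> oF oG a b ab; apply: big1 => i _; apply: big1 => j _.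
have := ltn_ord i; have := ltn_ord j => jb ia.
have [lt_p|ge_p] := ltnP (i + j) p; first by rewrite oF// mul0r.
by rewrite oG ?mulr0//; lia.
Qed.

Lemma psexp_order X n : order_ge 1 X -> order_ge n (psexp X n).
Proof. by move=> oX; elim: n => // n IH; apply: (psmul_order oX IH). Qed.

Lemma psexp_agree r X X' n : order_ge 1 X -> order_ge 1 X' ->
  agree_below (1 + r) X X' -> agree_below (n + r) (psexp X n) (psexp X' n).
Proof.
move=> oX oX' XX'; elim: n => // n IH.
by rewrite -add1n; apply: psmul_agree => //; apply: psexp_order.
Qed.

Lemma psX_order : order_ge 1 (psX : ps2 K).
Proof. by move=> [|a] [|b]. Qed.

Lemma psY_order : order_ge 1 (psY : ps2 K).
Proof. by move=> [|a] [|b]. Qed.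

Lemma psX_tangent_order X : agree_below 2 X psX -> order_ge 1 X.
Proof.
move=> X2; apply: agree_below_order psX_order.
exact: agree_belowW (agree_below_sym X2).
Qed.

Lemma psY_tangent_order Y : agree_below 2 Y psY -> order_ge 1 Y.
Proof.
move=> Y2; apply: agree_below_order psY_order.
exact: agree_belowW (agree_below_sym Y2).
Qed.

(** The derivative of the power map: if two series tangent to [x] first differ
    in degree [m], by [d] say, then their powers of exponent [p.+1] first
    differ in degree [p + m], by [p.+1 x^p d], because every other factor
    contributes through its leading term [x]. *)
Lemma psexp_first_order p m X X' a b :
  agree_below 2 X psX -> agree_below 2 X' psX -> agree_below m X X' ->
  (a + b <= p + m)%N ->
  psexp X' p.+1 a b - psexp X p.+1 a b =
  if (p <= a)%N then (X' (a - p)%N b - X (a - p)%N b) *+ p.+1 else 0.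
Proof.
move=> X2 X'2 XX'.
have [oX oX'] := (psX_tangent_order X2, psX_tangent_order X'2).
pose D : ps2 K := fun i j => X' i j - X i j.
have oD : order_ge m D by move=> i j ijm; rewrite /D XX' ?subrr.
elim: p a b => [|p IH] a b ab.
  by rewrite !psexpS /psexp /= !(psmulC _ (psconst 1)) psconst1E !psmul_monol !subn0 mulr1n.
pose E : ps2 K := fun i j => psexp X' p.+1 i j - psexp X p.+1 i j.
have EE i j : (i + j <= p + m)%N -> E i j =
    if (p <= i)%N then D (i - p)%N j *+ p.+1 else 0 by exact: IH.
have oE : order_ge (p + m) E.
  move=> i j ijm; rewrite EE; last exact: ltnW.
  by case: leqP => // pi; rewrite oD ?mul0rn//; lia.
(* Leibniz rule: U' V' - U V = (U' - U) V' + U (V' - V) *)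
have -> : psexp X' p.+2 a b - psexp X p.+2 a b =
    psmul D (psexp X' p.+1) a b + psmul X E a b.
  by rewrite psmulBl psmulBr !psexpS addrA subrK.
have -> : psmul D (psexp X' p.+1) a b = psmul D (psmono p.+1 0) a b.
  apply: (@psmul_agree m p.+1 1) => //; last by lia.
  - exact: psexp_order.
  - by have := @psmono_order p.+1 0; rewrite addn0.
  - by rewrite -psexpX; apply: psexp_agree => //; apply: psX_order.
have -> : psmul X E a b = psmul psX E a b.
  apply: (@psmul_agree 1 (p + m) 1) => //; last by lia.
  exact: psX_order.
rewrite psmulC !psmul_monol !subn0 !andbT.
case: (ltnP p a) => pa; last first.
  by rewrite add0r; case: ifP => // a0; rewrite EE; [case: leqP => //; lia | lia].
have -> : (0 < a)%N by lia.
rewrite EE; last by lia.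
have -> : (p <= a - 1)%N by lia.
have -> : (a - 1 - p = a - p.+1)%N by lia.
by rewrite -mulrS.
Qed.

(** * Substituting a pair of series tangent to the identity *)

Lemma psmonomial_agree r X X' Y Y' j l :
  order_ge 1 X -> order_ge 1 X' -> order_ge 1 Y -> order_ge 1 Y' ->
  agree_below (1 + r) X X' -> agree_below (1 + r) Y Y' ->
  agree_below (j + l + r) (psmul (psexp X j) (psexp Y l)) (psmul (psexp X' j) (psexp Y' l)).
Proof.
by move=> *; apply: psmul_agree; (exact: psexp_order || exact: psexp_agree).
Qed.

(** [X^j Y^l] is [x^j y^l] plus terms of higher degree, so in degree [a + b] the
    coefficients of [G] of that degree enter the substitution untouched, and
    all remaining terms involve coefficients of [G] of lower degree.  Those
    have degree at least [p], whence their monomials [X^j Y^l] see [X] and [Y]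
    only up to degree [a + b - p + 1]. *)
Lemma pssubst2_sub p r N G G' X X' Y Y' a b :
  agree_below 2 X psX -> agree_below 2 Y psY ->
  agree_below 2 X' psX -> agree_below 2 Y' psY ->
  order_ge p G -> order_ge p G' -> agree_below N G G' ->
  agree_below (1 + r) X X' -> agree_below (1 + r) Y Y' ->
  (a + b <= N)%N -> (a + b < p + r)%N ->
  pssubst2 G' X' Y' a b - pssubst2 G X Y a b = G' a b - G a b.
Proof.
move=> X2 Y2 X'2 Y'2 oG oG' GG' XX' YY' abN abr.
have [oX oX'] := (psX_tangent_order X2, psX_tangent_order X'2).
have [oY oY'] := (psY_tangent_order Y2, psY_tangent_order Y'2).
pose mon U V j l : ps2 K := psmul (psexp U j) (psexp V l).
have mon_diag U V j l : agree_below 2 U psX -> agree_below 2 V psY ->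
    (a + b <= j + l)%N -> mon U V j l a b = psmono j l a b.
  move=> U2 V2 ab; have -> : psmono j l = mon psX psY j l.
    by rewrite /mon psexpX psexpY psmul_mono addn0.
  apply: (@psmonomial_agree 1) => //; last by lia.
  - exact: psX_tangent_order.
  - exact: psX_order.
  - exact: psY_tangent_order.
  - exact: psY_order.
rewrite /pssubst2 -sumrB.
transitivity (\sum_(j < (a + b).+1) (j == a :> nat)%:R *
    \sum_(l < (a + b).+1) (l == b :> nat)%:R * (G' j l - G j l)).
  apply: eq_bigr => j _; rewrite -sumrB mulr_sumr; apply: eq_bigr => l _.
  rewrite mulrA -natrM mulnb -/(mon X Y j l) -/(mon X' Y' j l).
  have [small|large] := leqP (a + b) (j + l).
    by rewrite !mon_diag// -mulrBl mulrC /psmono [a == j]eq_sym [b == l]eq_sym.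
  rewrite (GG' j l) ?(leq_trans large)// subrr mulr0.
  have [jlp|jlp] := ltnP (j + l) p; first by rewrite oG' ?mul0r ?subrr.
  by rewrite /mon (psmonomial_agree oX oX' oY oY' XX' YY') ?subrr//; lia.
rewrite (sum_pick _ _ (fun j => \sum_(l < (a + b).+1) (l == b :> nat)%:R * (G' j l - G j l))).
by rewrite leq_addr (sum_pick _ _ (fun l => G' a l - G a l)) leq_addl.
Qed.

Lemma pssubst2_order p G X Y : agree_below 2 X psX -> agree_below 2 Y psY ->
  order_ge p (pssubst2 G X Y) -> order_ge p G.
Proof.
move=> X2 Y2 oS.
have G0 a b : pssubst2 (fun _ _ => 0) X Y a b = 0.
  by rewrite /pssubst2 big1// => j _; rewrite big1// => l _; rewrite mul0r.
suff low n : (n <= p)%N -> agree_below n (fun _ _ => 0) G.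
  by move=> a b ab; rewrite -(low p).
elim: n => // n IH np a b; rewrite ltnS => abn.
have := @pssubst2_sub 0 n.+1 n (fun _ _ => 0) G X X Y Y a b X2 Y2 X2 Y2.
rewrite G0 oS; last exact: leq_ltn_trans np.
rewrite subrr subr0 => <- //; exact: IH (ltnW np).
Qed.

(** Back-substitution: the coefficients of degree [m] are chosen so as to repair
    what the lower ones leave over.  Since [unsubst_below S X Y m] vanishes from
    degree [m] on, it contributes to degree [m] of the substitution through
    lower terms only. *)
Fixpoint unsubst_below (S X Y : ps2 K) (n : nat) : ps2 K :=
  if n is m.+1 then
    let G := unsubst_below S X Y m in
    fun a b => if (a + b == m)%N then S a b - pssubst2 G X Y a b else G a b
  else fun _ _ => 0.

Lemma pssubst2_surj S X Y : agree_below 2 X psX -> agree_below 2 Y psY ->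
  exists G, pssubst2 G X Y =2 S.
Proof.
move=> X2 Y2; pose U := unsubst_below S X Y.
have Uge n a b : (n <= a + b)%N -> U n a b = 0.
  by elim: n => // n IH abn; rewrite /U /= gtn_eqF//; apply: IH; exact: ltnW.
have Ust n d a b : (a + b < n)%N -> U (d + n)%N a b = U n a b.
  by move=> abn; elim: d => // d <-; rewrite addSn {1}/U /= ltn_eqF//; lia.
exists (fun a b => U (a + b).+1 a b) => a b.
have := @pssubst2_sub 0 (a + b).+1 (a + b) (U (a + b)%N)
          (fun a b => U (a + b).+1 a b) X X Y Y a b X2 Y2 X2 Y2.
rewrite (Uge (a + b)%N)// [in RHS]/U /= eqxx -/(U _) subr0 => h.
apply/eqP; rewrite -(inj_eq (addIr (- pssubst2 (U (a + b)%N) X Y a b))) h// => c d cd.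
have -> : (a + b = (a + b - (c + d).+1) + (c + d).+1)%N by lia.
by rewrite Ust.
Qed.

End Series.

(** * Infinite triangular systems *)

Definition update (D : Type) (d : nat -> D) (n : nat) (c : D) : nat -> D :=
  fun i => if i == n then c else d i.

(** The unknowns can be fixed one after another: by locality, a later choice
    disturbs no earlier condition, and two solutions cannot differ for a first
    time. *)
Lemma triangular_exists_unique (D : Type) (d0 : D) (P : nat -> (nat -> D) -> Prop) :
  (forall n d d', (forall i, (i <= n)%N -> d i = d' i) -> P n d -> P n d') ->
  (forall n d, exists! c, P n (update d n c)) ->
  exists! d, forall n, P n d.
Proof.
move=> Ploc Pstep.
have [c cP] := @choice _ _ (fun nd c => P nd.1 (update nd.2 nd.1 c))
  (fun nd => let: ex_intro c (conj Pc _) := Pstep nd.1 nd.2 in ex_intro _ c Pc).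
(* S n has its first n terms right; the default d0 fills the others. *)
pose S := fix S n := if n is m.+1 then update (S m) m (c (m, S m)) else fun=> d0.
have S_stable n j i : (i < n)%N -> S (j + n)%N i = S n i.
  by move=> ij; elim: j => // j <-; rewrite /= /update ltn_eqF// ltn_addl.
exists (fun n => S n.+1 n); split=> [n|d' Pd'].
  apply: Ploc (cP (n, S n)) => i ilen.
  by have /= := S_stable i.+1 (n - i)%N i (ltnSn i); rewrite addnS subnK.
apply/funext => n; elim/ltn_ind: n => n IH.
have [c0 [_ c0U]] := Pstep n d'.
have <- : c0 = d' n.
  by apply/c0U/Ploc/Pd' => i _; rewrite /update; case: eqP => [->|].
apply/esym/c0U; apply: Ploc (cP (n, S n)) => i ilen /=.
rewrite /update; case: eqP => [_|/eqP ni]; first by rewrite /S /update eqxx.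
have lt_in : (i < n)%N by rewrite ltn_neqAle ni.
by have := S_stable i.+1 (n - i.+1)%N i (ltnSn i); rewrite subnK// -IH.
Qed.

(** * The effect of a transformation on the coefficients *)

Section Transformations.
Variable R : realType.
Local Notation C := R[i].
Local Notation "'I" := ('i%C : R[i]).
Implicit Types (f g : nat -> C) (F Fs : ps2 R) (T : (nat -> C) * (nat -> C)).

(** The coefficient of [x^a y^b] in [c z^(a + b)]. *)
Definition zcoef (c : C) : ps2 C := fun a b => c * 'C(a + b, a)%:R * 'I ^+ b.

Lemma psexp_zser n a b :
  psexp (zser R) n a b = if (a + b == n)%N then zcoef 1 a b else 0.
Proof.
rewrite /zcoef mul1r; elim: n a b => [|n IH] a b.
  by rewrite /psexp /= /psconst addn_eq0; case: a b => [|a] [|b]; rewrite ?mul1r ?expr0//= bin0.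
(* Multiplying by x + iy turns the claim into the Pascal recurrence. *)
have -> : psexp (zser R) n.+1 a b =
    psmul psX (psexp (zser R) n) a b + 'I * psmul psY (psexp (zser R) n) a b.
  rewrite psexpS mulr_sumr; apply: etrans (big_split _ _ _ _ _).
  apply: eq_bigr => i _; rewrite mulr_sumr; apply: etrans (big_split _ _ _ _ _).
  apply: eq_bigr => j _ /=.
  rewrite mulrA -mulrDl; congr (_ * _).
  rewrite [LHS]complexE /zser /pscomplex /psX /psY /=.
  by case: (_ && _); case: (_ && _); rewrite /= ?complexr0.
rewrite !psmul_monol !IH /= !andbT !subn0.
case: a b => [|a] [|b]; rewrite ?subn1 ?subn0 ?addn0 ?add0n ?mulr0 ?add0r ?addr0 //=.
- by rewrite eqSS; case: eqP => _; rewrite ?mulr0// !bin0 !mul1r exprS.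
- by rewrite eqSS !binn.
rewrite !addSn !addnS !eqSS; case: eqP => _; last by rewrite mulr0 addr0.
by rewrite [in RHS]binS natrD mulrDl [RHS]addrC (mulrCA 'I) -exprS.
Qed.

Lemma pssubst1_zser f a b : pssubst1 f (zser R) a b = zcoef (f (a + b)%N) a b.
Proof.
rewrite /pssubst1 big_ord_recr/= psexp_zser eqxx big1 ?add0r; last first.
  by move=> i _; rewrite psexp_zser gtn_eqF ?mulr0.
by rewrite /zcoef mul1r mulrA.
Qed.

Lemma zcoefB c c' a b : zcoef (c - c') a b = zcoef c a b - zcoef c' a b.
Proof. by rewrite /zcoef !mulrBl. Qed.

Lemma zcoef0 a b : zcoef 0 a b = 0.
Proof. by rewrite /zcoef !mul0r. Qed.

Lemma ReB (x y : C) : complex.Re (x - y) = complex.Re x - complex.Re y.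
Proof. by case: x; case: y. Qed.

Lemma ImB (x y : C) : complex.Im (x - y) = complex.Im x - complex.Im y.
Proof. by case: x; case: y. Qed.

Lemma Re_zstar T a b :
  psRe (zstar T) a b = psX a b + complex.Re (zcoef (T.1 (a + b)%N) a b).
Proof. by rewrite /psRe /zstar /psadd pssubst1_zser; case: zcoef. Qed.

Lemma Im_zstar T a b :
  psIm (zstar T) a b = psY a b + complex.Im (zcoef (T.1 (a + b)%N) a b).
Proof. by rewrite /psIm /zstar /psadd pssubst1_zser; case: zcoef. Qed.

Lemma Im_wstar k F T u a b :
  psIm (wstar k F T u) a b =
  psexp psX k a b + F a b + complex.Im (zcoef (T.2 (a + b)%N) a b).
Proof. by rewrite /psIm /wstar /wser /psadd pssubst1_zser; case: zcoef. Qed.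

Lemma Re_zstar_tangent k T : transformation k T -> agree_below 2 (psRe (zstar T)) psX.
Proof. by move=> [T1 _] a b ab; rewrite Re_zstar T1// zcoef0 addr0. Qed.

Lemma Im_zstar_tangent k T : transformation k T -> agree_below 2 (psIm (zstar T)) psY.
Proof. by move=> [T1 _] a b ab; rewrite Im_zstar T1// zcoef0 addr0. Qed.

(** Any transformation carries the hypersurface to one of the same shape: the
    real and imaginary parts of [z*] are tangent to [x] and [y], so the new
    graph is found by back-substitution.  It starts in degree [k + 1] because
    [x*^k] and [x^k] agree up to degree [k]. *)
Lemma takes_into_exists k F T : (0 < k)%N -> order_ge k.+1 F -> transformation k T ->
  exists Fs, order_ge k.+1 Fs /\ takes_into k T F Fs.
Proof.
move=> k0 oF tT; have [X2 Y2] := (Re_zstar_tangent tT, Im_zstar_tangent tT).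
set X := psRe _ in X2; set Y := psIm _ in Y2.
pose S a b := psIm (wstar k F T 0) a b - psexp X k a b.
have [Fs FsE] := pssubst2_surj S X2 Y2.
exists Fs; split; last first.
  move=> u a b; rewrite /psadd -/X -/Y FsE /S.
  by rewrite addrC subrK !Im_wstar.
apply: (pssubst2_order X2 Y2) => a b ab.
rewrite FsE /S Im_wstar oF// tT.2// zcoef0 !addr0.
rewrite (psexp_agree (n := k) (r := 1) _ _ X2) ?addn1 ?subrr//.
  exact: psX_tangent_order.
exact: psX_order.
Qed.

(** The linearised equation.  [x*^(k+1)] varies to first order by
    [(k + 1) x^k] times the variation of [x*], the second component enters
    linearly, and the variation of [Fs] through its substituted arguments is of
    higher degree than [k + m], as [Fs] has order at least [k + 2].  Hence the
    first degree in which the graph can change is [k + m], although the first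
    component changes from degree [m] on. *)
Lemma takes_into_sub k m F T T' Fs Fs' a b :
  (1 < m)%N -> transformation k.+1 T -> transformation k.+1 T' ->
  order_ge k.+2 Fs -> order_ge k.+2 Fs' ->
  takes_into k.+1 T F Fs -> takes_into k.+1 T' F Fs' ->
  (forall i, (i < m)%N -> T.1 i = T'.1 i) ->
  (forall i, (i < k + m)%N -> T.2 i = T'.2 i) ->
  (a + b <= k + m)%N ->
  Fs' a b - Fs a b =
    complex.Im (zcoef (T'.2 (a + b)%N - T.2 (a + b)%N) a b) -
    (if (k <= a)%N then
       complex.Re (zcoef (T'.1 (a - k + b)%N - T.1 (a - k + b)%N) (a - k)%N b) *+ k.+1
     else 0).
Proof.
move=> m1 tT tT' oFs oFs' eqT eqT' ff gg.
have [X2 Y2] := (Re_zstar_tangent tT, Im_zstar_tangent tT).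
have [X'2 Y'2] := (Re_zstar_tangent tT', Im_zstar_tangent tT').
have XX : agree_below m (psRe (zstar T)) (psRe (zstar T')).
  by move=> i j ij; rewrite !Re_zstar ff.
have YY : agree_below m (psIm (zstar T)) (psIm (zstar T')).
  by move=> i j ij; rewrite !Im_zstar ff.
(* Read in degree N, assuming that the graphs agree below N. *)
have step N c d : (N <= k + m)%N -> agree_below N Fs Fs' -> (c + d <= N)%N ->
  Fs' c d - Fs c d =
    complex.Im (zcoef (T'.2 (c + d)%N - T.2 (c + d)%N) c d) -
    (if (k <= c)%N then
       complex.Re (zcoef (T'.1 (c - k + d)%N - T.1 (c - k + d)%N) (c - k)%N d) *+ k.+1
     else 0).
  move=> Nkm FN cdN.
  rewrite -(@pssubst2_sub _ k.+2 m.-1 N Fs Fs' _ _ _ _ c d X2 Y2 X'2 Y'2)//; first last.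
  - by lia.
  - by rewrite add1n prednK// ltnW.
  - by rewrite add1n prednK// ltnW.
  have := eqT 0 c d; have := eqT' 0 c d; rewrite !Im_wstar /psadd => E' E.
  have := psexp_first_order X2 X'2 XX (leq_trans cdN Nkm).
  rewrite !zcoefB ImB ReB !Re_zstar opprD addrACA subrr add0r => <-.
  rewrite -[pssubst2 Fs' _ _ c d](addKr (psexp (psRe (zstar T')) k.+1 c d)) -E'.
  rewrite -[pssubst2 Fs _ _ c d](addKr (psexp (psRe (zstar T)) k.+1 c d)) -E.
  by ring.
(* Below degree k + m the first-order terms vanish, so agreement propagates. *)
have agree N : (N <= k + m)%N -> agree_below N Fs Fs'.
  elim: N => // N IH Nkm c d; rewrite ltnS => cdN.
  apply/eqP; rewrite eq_sym -subr_eq0 (step N)//; last 2 first.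
  - exact: ltnW.
  - by apply: IH; exact: ltnW.
  rewrite gg; last by lia.
  rewrite subrr zcoef0 sub0r; case: leqP => // kc; last by rewrite oppr0.
  by rewrite ff ?subrr ?zcoef0 ?mul0rn ?oppr0//; lia.
by move=> abkm; apply: (step (k + m)%N) => //; apply: agree.
Qed.

(** * Solving the normalisation conditions degree by degree *)

Lemma zcoef_Re c a b : complex.Re (zcoef c a b) = complex.Im (zcoef (c * 'I) a b).
Proof. by rewrite -ImiRe /zcoef; congr complex.Im; ring. Qed.

(** With [h = c i^n], the two coefficients are [Re h] and [(n + 1) Im h], so they
    may be prescribed freely and determine [c]. *)
Lemma exists_unique_Im_jet n (p q : R) :
  exists! c : C, complex.Im (zcoef c 0 n.+1) = p /\ complex.Im (zcoef c 1 n) = q.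
Proof.
have I0 : 'I ^+ n != 0.
  by rewrite expf_neq0// eq_complex /= oner_eq0 andbF.
have jetE c : complex.Im (zcoef c 0 n.+1) = complex.Re (c * 'I ^+ n) /\
    complex.Im (zcoef c 1 n) = complex.Im (c * 'I ^+ n) *+ n.+1.
  split; first by rewrite -ImiRe /zcoef bin0 mulr1 exprSr mulrA.
  rewrite /zcoef add1n bin1 mulrAC mulr_natr.
  by elim: n.+1 (c * _) => // N IH [x y]; rewrite !mulrS -IH; case: (_ *+ N).
pose h := (p +i* (q / n.+1%:R))%C.
exists (h / 'I ^+ n); split.
  have [-> ->] := jetE (h / 'I ^+ n).
  rewrite divfK//; split=> //=; rewrite -[LHS]mulr_natr divfK ?pnatr_eq0//.
move=> c; have [-> ->] := jetE c => -[rp rq]; apply: (mulIf I0); rewrite divfK//.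
move: rp rq; rewrite /h; case: (c * _) => x y /= -> <-.
by rewrite -[y *+ _]mulr_natr mulfK ?pnatr_eq0.
Qed.

Lemma exists_unique_Re_jet n (p q : R) :
  exists! c : C, complex.Re (zcoef c 0 n.+1) = p /\ complex.Re (zcoef c 1 n) = q.
Proof.
have I0 : 'I != 0 by rewrite eq_complex /= oner_eq0 andbF.
have [c [[cp cq] cU]] := exists_unique_Im_jet n p q.
exists (c / 'I); split=> [|c']; first by rewrite !zcoef_Re divfK.
by rewrite !zcoef_Re => /cU ->; rewrite mulfK.
Qed.

(** The part of [rigid_t_normal k.+1] that concerns the terms of total degree
    [k + n + 2]. *)
Definition normal_at (k n : nat) Fs : Prop :=
  [/\ Fs 0%N (k + n).+2 = 0, Fs 1%N (k + n).+1 = 0,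
      Fs k n.+2 = 0 & Fs k.+1 n.+1 = 0].

Lemma rigid_t_normalP k Fs : order_ge k.+2 Fs ->
  rigid_t_normal k.+1 Fs <-> forall n, normal_at k n Fs.
Proof.
move=> oFs; split=> [nF n|nF j].
  have [h0 _ _ _] := nF (k + n).+2; have [_ h1 _ _] := nF (k + n).+1.
  by have [_ _ h2 _] := nF n.+2; have [_ _ _ h3] := nF n.+1.
split.
- have [jk|jk] := ltnP j k.+2; first by rewrite oFs.
  have [+ _ _ _] := nF (j - k.+2)%N; congr (Fs _ _ = _); lia.
- have [jk|jk] := ltnP j k.+1; first by rewrite oFs.
  have [_ + _ _] := nF (j - k.+1)%N; congr (Fs _ _ = _); lia.
- case: j => [|[|j]]; [by rewrite oFs//; lia|by rewrite oFs//; lia|].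
  by have [] := nF j.
- case: j => [|j]; [by rewrite oFs//; lia|].
  by have [] := nF j.
Qed.

(** The [n]-th term of [d] holds the coefficients of [z^(n + 2)] in [z*] and of
    [z^(n + k + 2)] in [w*], the two that first matter in degree [k + n + 2]
    when the leading exponent is [k.+1]. *)
Definition coeff_transformation (k : nat) (d : nat -> C * C) : (nat -> C) * (nat -> C) :=
  (fun i => if (i < 2)%N then 0 else (d (i - 2)%N).1,
   fun i => if (i < k.+2)%N then 0 else (d (i - k.+2)%N).2).

Lemma coeff_transformationP k d : transformation k.+1 (coeff_transformation k d).
Proof. by split=> i /= ->. Qed.

Lemma coeff_transformation_surj k T : transformation k.+1 T ->
  exists d, coeff_transformation k d = T.
Proof.
case: T => f g [/= f0 g0]; exists (fun s => (f s.+2, g (s + k.+2)%N)).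
rewrite /coeff_transformation; congr pair; apply/funext => i /=.
  by case: ltnP => [/f0|i2]//; rewrite -addn2 subnK.
by case: ltnP => [/g0|ik]//; rewrite subnK.
Qed.

Lemma takes_into_agree k m F T T' Fs Fs' :
  (1 < m)%N -> transformation k.+1 T -> transformation k.+1 T' ->
  order_ge k.+2 Fs -> order_ge k.+2 Fs' ->
  takes_into k.+1 T F Fs -> takes_into k.+1 T' F Fs' ->
  (forall i, (i < m)%N -> T.1 i = T'.1 i) ->
  (forall i, (i < k + m)%N -> T.2 i = T'.2 i) ->
  agree_below (k + m) Fs Fs'.
Proof.
move=> m1 tT tT' oFs oFs' eqT eqT' ff gg a b ab.
apply/eqP; rewrite eq_sym -subr_eq0.
rewrite (takes_into_sub m1 tT tT' oFs oFs' eqT eqT' ff gg (ltnW ab)) gg// subrr zcoef0 sub0r.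
case: leqP => ka; last by rewrite oppr0.
by rewrite ff ?subrr ?zcoef0 ?mul0rn ?oppr0//; lia.
Qed.

Lemma takes_into_unique k F T Fs Fs' : transformation k.+1 T ->
  order_ge k.+2 Fs -> order_ge k.+2 Fs' ->
  takes_into k.+1 T F Fs -> takes_into k.+1 T F Fs' -> Fs = Fs'.
Proof.
move=> tT oFs oFs' eqT eqT'; apply: ps2P => a b.
by apply: (@takes_into_agree k (a + b).+2 F T T) => //; lia.
Qed.


Definition normalizes_at k F n (d : nat -> C * C) : Prop :=
  exists Fs, [/\ order_ge k.+2 Fs, takes_into k.+1 (coeff_transformation k d) F Fs
    & normal_at k n Fs].

Lemma normalizes_at_local k F n d d' : order_ge k.+2 F ->
  (forall i, (i <= n)%N -> d i = d' i) ->
  normalizes_at k F n d -> normalizes_at k F n d'.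
Proof.
move=> oF dd' [Fs [oFs tFs [h0 h1 h2 h3]]].
have tT := @coeff_transformationP k.
have [Fs' [oFs' tFs']] := takes_into_exists (ltn0Sn k) oF (tT d').
exists Fs'; split=> //.
have agree : agree_below (k + n.+3) Fs Fs'.
  apply: (takes_into_agree _ (tT d) (tT d') oFs oFs' tFs tFs') => // i ib /=.
    by case: ltnP => // i2; rewrite dd'//; lia.
  by case: ltnP => // ik; rewrite dd'//; lia.
by split; rewrite -agree//; lia.
Qed.

(** The four conditions decouple because [k > 1]: the term [x^k Re (f z^(n + 2))]
    does not reach the coefficients of [x^0] and [x^1], so these determine [g];
    the coefficients of [x^k] and [x^(k + 1)] then determine [f]. *)
Lemma normalizes_at_step k F n d : (1 < k)%N -> order_ge k.+2 F ->
  exists! c, normalizes_at k F n (update d n c).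
Proof.
move=> k1 oF.
have tT := @coeff_transformationP k.
pose T c := coeff_transformation k (update d n c).
(* G is the graph obtained with the n-th pair of coefficients set to zero. *)
have [G [oG tG]] := takes_into_exists (ltn0Sn k) oF (tT (update d n (0, 0))).
have Tn c : (T c).1 n.+2 = c.1 /\ (T c).2 (k + n).+2 = c.2.
  split; rewrite /T /update /=.
    by rewrite !subSS subn0 eqxx.
  by rewrite !ltnS ltnNge leq_addr !subSS addKn eqxx.
have Tlow c c' i : ((i < n.+2)%N -> (T c).1 i = (T c').1 i) /\
    ((i < (k + n).+2)%N -> (T c).2 i = (T c').2 i).
  split=> ib /=; case: ltnP => // ib'; rewrite /update ltn_eqF//; lia.
have GE c Fs a b : order_ge k.+2 Fs -> takes_into k.+1 (T c) F Fs ->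
    (a + b = (k + n).+2)%N -> Fs a b = G a b +
      (complex.Im (zcoef c.2 a b) -
       (if (k <= a)%N then complex.Re (zcoef c.1 (a - k)%N b) *+ k.+1 else 0)).
  move=> oFs tFs ab; apply/eqP; rewrite addrC -subr_eq; apply/eqP.
  rewrite (@takes_into_sub k n.+2 F (T (0, 0)) (T c) G Fs a b)//; first last.
  - by rewrite ab !addnS.
  - by move=> i; rewrite !addnS => /(Tlow (0, 0) c i).2.
  - by move=> i /(Tlow (0, 0) c i).1.
  - exact: tT.
  - exact: tT.
  rewrite ab !(Tn _).2 subr0; congr (_ - _); case: leqP => // ka.
  have -> : (a - k + b = n.+2)%N by lia.
  by rewrite !(Tn _).1 subr0.
have [g [[g0 g1] gU]] := exists_unique_Im_jet (k + n).+1 (- G 0 (k + n).+2) (- G 1 (k + n).+1).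
pose r a b := (G a b + complex.Im (zcoef g a b)) / k.+1%:R.
have [f [[f0 f1] fU]] := exists_unique_Re_jet n.+1 (r k n.+2) (r k.+1 n.+1).
have normalE c Fs : order_ge k.+2 Fs -> takes_into k.+1 (T c) F Fs ->
    normal_at k n Fs <-> c = (f, g).
  move=> oFs tFs; rewrite /normal_at !(GE c Fs)//; try lia.
  rewrite [(k <= 0)%N]leqn0 [(k <= 1)%N]leqNgt k1 gtn_eqF ?(ltnW k1)//=.
  rewrite leqnn leqnSn subnn subSnn !subr0.
  have solve_Im x y : x + y = 0 :> R <-> y = - x.
    by split=> [/eqP|->]; rewrite ?subrr// addrC addr_eq0 => /eqP.
  have solve_Re (x y z : R) : x + (y - z *+ k.+1) = 0 <-> z = (x + y) / k.+1%:R.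
    rewrite addrA -(mulr_natr z); split=> [/eqP|->]; last by rewrite divfK ?subrr ?pnatr_eq0.
    by rewrite subr_eq0 => /eqP->; rewrite mulfK ?pnatr_eq0.
  split=> [[/solve_Im h0 /solve_Im h1 /solve_Re h2 /solve_Re h3]|->]/=; last first.
    by split; [exact/solve_Im|exact/solve_Im|exact/solve_Re|exact/solve_Re].
  have gc : g = c.2 by apply: gU.
  by rewrite [c]surjective_pairing gc (fU c.1)// /r gc.
have [Fs [oFs tFs]] := takes_into_exists (ltn0Sn k) oF (tT (update d n (f, g))).
exists (f, g); split; first by exists Fs; split=> //; apply/(normalE _ _ oFs tFs).
by move=> c [Fs' [oFs' tFs' /(normalE _ _ oFs' tFs')]].
Qed.

End Transformations.

(** * Existence and uniqueness of the normalisation *)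

Theorem lemma4p1 (R : realType) (k : nat) (F : ps2 R)
    (hk : (2 < k)%N) (hF : order_ge k.+1 F) :
  exists! T : (nat -> R[i]) * (nat -> R[i]),
    transformation k T /\
    exists Fs : ps2 R,
      [/\ order_ge k.+1 Fs, takes_into k T F Fs & rigid_t_normal k Fs].
Proof.
case: k hk hF => // k k1 oF.
have [d [Pd dU]] := triangular_exists_unique ((0, 0) : R[i] * R[i])
  (fun n d d' => @normalizes_at_local R k F n d d' oF)
  (fun n d => @normalizes_at_step R k F n d k1 oF).
have tT := @coeff_transformationP R k.
exists (coeff_transformation k d); split.
  split; first exact: tT.
  have [Fs [oFs tFs _]] := Pd 0%N; exists Fs; split=> //.
  apply/(rigid_t_normalP oFs) => n; have [Fs' [oFs' tFs' nFs']] := Pd n.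
  by rewrite (takes_into_unique (tT d) oFs oFs' tFs tFs').
move=> _ [/coeff_transformation_surj[d' <-] [Fs [oFs tFs nFs]]].
have {}nFs := (rigid_t_normalP oFs).1 nFs.
by congr coeff_transformation; apply: dU => n; exists Fs.
Qed.
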